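(* Let $(L,M)$ be an integral chip-firing pair, i.e. $L$ and $M$ are $n\times n$ integer matrices with $L$ invertible (over $\mathbb{R}$) and $M$ an invertible $M$-matrix. Let $\vec{c}\in S^+$ be a valid configuration for $(L,M)$. Then: (1) $\vec{c}$ is $z$-superstable for $(L,M)$ if and only if $\lfloor ML^{-1}\vec{c}\rfloor$ is $z$-superstable for $M$; (2) $\vec{c}$ is critical for $(L,M)$ if and only if $\lfloor ML^{-1}\vec{c}\rfloor$ is critical for $M$.
   Context: An (invertible) $M$-matrix is a real $n\times n$ matrix $M$ with $M_{ii}>0$ for all $i$, $M_{ij}\le 0$ for $i\ne j$, which is invertible with all entries of $M^{-1}$ nonnegative. A chip-firing pair $(L,M)$ consists of an invertible $n\times n$ matrix $L$ and an $n\times n$ invertible $M$-matrix $M$; it is integral if both matrices have integer entries. The set of valid configurations of $(L,M)$ is $S^+=\{LM^{-1}\vec{x} : \vec{x}\in\mathbb{R}^n_{\ge 0},\ LM^{-1}\vec{x}\in\mathbb{Z}^n\}$, equivalently $S^+=\{\vec{c}\in\mathbb{Z}^n : ML^{-1}\vec{c}\ge \vec{0}\}$ (entrywise). For a chip-firing pair $(L,M)$ and $\vec{c}\in S^+$: - Site $i\in\{1,\dots,n\}$ is ready to fire at $\vec{c}$ if $\vec{c}-L\vec{e}_i\in S^+$ ($\vec{e}_i$ the standard basis vector). $\vec{c}$ is stable if no site is ready to fire. - $\vec{c}$ is $z$-superstable if $\vec{c}-L\vec{z}\notin S^+$ for every nonzero $\vec{z}\in\mathbb{Z}^n_{\ge0}$.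 - $\vec{c}$ is reachable if there is $\vec{d}\in S^+$ with $\vec{d}-L\vec{e}_i\in S^+$ for all $i=1,\dots,n$ and a finite sequence $i_1,\dots,i_k$ with $\vec{c}=\vec{d}-\sum_{j=1}^k L\vec{e}_{i_j}$ and $\vec{d}-\sum_{j=1}^{\ell}L\vec{e}_{i_j}\in S^+$ for all $\ell\le k$. - $\vec{c}$ is critical if it is stable and reachable. ''$z$-superstable for $M$'' and ''critical for $M$'' mean these notions for the chip-firing pair $(M,M)$, whose valid configurations are $\mathbb{Z}^n_{\ge 0}$ (so firing $i$ subtracts $M\vec{e}_i$ and validity means nonnegative entries). $\lfloor\vec{v}\rfloor$ denotes the entrywise floor. *)

(* Defs.v *)
From mathcomp Require Import all_boot all_order all_algebra.
From mathcomp Require Import reals.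

Set Implicit Arguments.
Unset Strict Implicit.
Unset Printing Implicit Defensive.

Import Order.TTheory GRing.Theory Num.Theory.
Local Open Scope ring_scope.

Section ChipFiring.
Context {R : realType} {n : nat}.
Implicit Types (L M : 'M[R]_n) (c z : 'cV[R]_n).

Definition M_matrix M : Prop :=
  [/\ forall i, 0 < M i i,
      forall i j, i != j -> M i j <= 0,
      M \in unitmx &
      forall i j, 0 <= invmx M i j].

Definition chip_firing_pair L M : Prop := L \in unitmx /\ M_matrix M.

Definition integral_pair L M : Prop :=
  L \is a mxOver Num.int /\ M \is a mxOver Num.int.

(* Since [L] may be a real matrix, configurations are real vectors, and
   membership in Z^n is part of validity. *)
Definition valid L M c : Prop :=
  c \is a mxOver Num.int /\
  exists2 x : 'cV[R]_n, (forall i, 0 <= x i 0) & c = L *m invmx M *m x.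

Definition basis_vec (i : 'I_n) : 'cV[R]_n := delta_mx i 0.

Definition ready L M c (i : 'I_n) : Prop := valid L M (c - L *m basis_vec i).

(* The notions below are only meant for valid configurations, so validity of
   [c] is included in them ([reachable] implies it, taking [l = size s]). *)
Definition stable L M c : Prop :=
  valid L M c /\ forall i, ~ ready L M c i.

Definition z_superstable L M c : Prop :=
  valid L M c /\
  forall z, z \is a mxOver Num.nat -> z != 0 -> ~ valid L M (c - L *m z).

(* [s] is the firing sequence i_1, ..., i_k. *)
Definition reachable L M c : Prop :=
  exists (d : 'cV[R]_n) (s : seq 'I_n),
    [/\ valid L M d,
        forall i, valid L M (d - L *m basis_vec i),
        c = d - \sum_(i <- s) L *m basis_vec i &
        forall l, (l <= size s)%N ->
          valid L M (d - \sum_(i <- take l s) L *m basis_vec i)].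

Definition critical L M c : Prop := stable L M c /\ reachable L M c.

Definition floor_vec (v : 'cV[R]_n) : 'cV[R]_n :=
  map_mx (fun a => (Num.floor a)%:~R) v.

End ChipFiring.

(* Main.v *)
Require Import Defs.
From mathcomp Require Import all_boot all_order all_algebra.
From mathcomp Require Import reals.

(** Put [x := M L^-1 c].  Firing an integer vector [z] changes [c] into
    [c - L z], hence [x] into [x - M z].  As [L] and [M] are integral, [c - L z]
    is integral and [M z] is an integer vector; and for an integer [m] one has
    [m <= x_i] exactly when [m <= floor x_i].  So [c - L z] is valid for [(L, M)]
    if and only if [floor x - M z] is valid for [(M, M)]
    ([valid_sub_floor_vec]).

    Superstability, stability and reachability of [c] depend only on the set of
    integer vectors [z] for which [c - L z] is valid.  This is visible for the
    first two.  For reachability, a starting configuration [d] from which [c] is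
    reached along the firing sequence [s] is determined by [s], namely
    [d = c + L z0] with [z0] the firing vector of [s], so that every
    configuration met on the way is again [c] minus [L] times an integer vector.
    Two configurations with the same such set therefore have the same
    properties ([z_superstable_transfer], [critical_transfer]), and the theorem
    is the case of [c] and [floor x]. *)

Import Order.TTheory GRing.Theory Num.Theory.
Local Open Scope ring_scope.

Section FiringEquivalence.
Context {R : realType} {n : nat}.
Implicit Types (L M : 'M[R]_n) (c z : 'cV[R]_n) (s : seq 'I_n).

Lemma mxOver_intM p q r (A : 'M[R]_(p, q)) (B : 'M[R]_(q, r)) :
  A \is a mxOver Num.int -> B \is a mxOver Num.int ->
  A *m B \is a mxOver Num.int.
Proof.
move=> /mxOverP hA /mxOverP hB; apply/mxOverP => i j; rewrite mxE.
by apply: rpred_sum => k _; apply: rpredM.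
Qed.

Lemma mxOver_intB p q (A B : 'M[R]_(p, q)) :
  A \is a mxOver Num.int -> B \is a mxOver Num.int -> A - B \is a mxOver Num.int.
Proof.
move=> /mxOverP hA /mxOverP hB; apply/mxOverP => i j; rewrite !mxE.
exact: rpredB.
Qed.

Lemma mxOver_int0 p q : (0 : 'M[R]_(p, q)) \is a mxOver Num.int.
Proof. by apply: mxOver0; apply: rpred0. Qed.

Lemma mxOver_nat_int p q (A : 'M[R]_(p, q)) :
  A \is a mxOver Num.nat -> A \is a mxOver Num.int.
Proof. by move=> /mxOverP hA; apply/mxOverP => i j; apply: intr_nat. Qed.

Lemma basis_vec_int (i : 'I_n) : (basis_vec i : 'cV[R]_n) \is a mxOver Num.int.
Proof. by apply/mxOverP => j k; rewrite mxE; apply: intr_nat; rewrite natr_nat. Qed.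

Definition firing_vec s : 'cV[R]_n := \sum_(i <- s) basis_vec i.

Lemma firing_vec_int s : firing_vec s \is a mxOver Num.int.
Proof.
apply/mxOverP => i j; rewrite summxE; apply: rpred_sum => k _.
by apply: (mxOverP (basis_vec_int k)).
Qed.

Lemma sum_mul_basis_vec L s :
  \sum_(i <- s) L *m basis_vec i = L *m firing_vec s.
Proof. by rewrite mulmx_sumr. Qed.

Lemma floor_vec_int (x : 'cV[R]_n) : floor_vec x \is a mxOver Num.int.
Proof. by apply/mxOverP => i j; rewrite mxE; apply: intr_int. Qed.

Lemma validP {L M c} : L \in unitmx -> M \in unitmx ->
  valid L M c <->
  c \is a mxOver Num.int /\ forall i, 0 <= (M *m invmx L *m c) i 0.
Proof.
move=> uL uM; split=> -[cint].
  by case=> x x0 cE; split=> // i; rewrite cE !mulmxA mulmxKV // mulmxV // mul1mx.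
move=> x0; split=> //; exists (M *m invmx L *m c) => //.
by rewrite !mulmxA mulmxKV // mulmxV // mul1mx.
Qed.

Lemma valid_sub_mul {L M c z} : L \in unitmx -> M \in unitmx ->
  L \is a mxOver Num.int -> c \is a mxOver Num.int -> z \is a mxOver Num.int ->
  valid L M (c - L *m z) <->
  forall i, (M *m z) i 0 <= (M *m invmx L *m c) i 0.
Proof.
move=> uL uM Lint cint zint; rewrite validP // mulmxBr mulmxA mulmxKV //.
split=> [[_ h] i|h]; first by have := h i; rewrite !mxE subr_ge0.
split=> [|i]; last by have := h i; rewrite !mxE subr_ge0.
by apply: mxOver_intB => //; apply: mxOver_intM.
Qed.

(** The floor absorbs the fractional part of [M L^-1 c], which no comparison
    with an integer vector [M z] can detect. *)
Lemma valid_sub_floor_vec L M c z : L \in unitmx -> M \in unitmx ->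
  L \is a mxOver Num.int -> M \is a mxOver Num.int ->
  c \is a mxOver Num.int -> z \is a mxOver Num.int ->
  valid L M (c - L *m z) <->
  valid M M (floor_vec (M *m invmx L *m c) - M *m z).
Proof.
move=> uL uM Lint Mint cint zint.
rewrite (valid_sub_mul uL uM) // (valid_sub_mul uM uM) ?floor_vec_int //.
rewrite mulmxV // mul1mx.
have /mxOverP Mz := mxOver_intM _ _ _ _ _ Mint zint.
suff E i : (M *m z) i 0 <= floor_vec (M *m invmx L *m c) i 0 =
           ((M *m z) i 0 <= (M *m invmx L *m c) i 0).
  by split=> h i; [rewrite E | rewrite -E].
rewrite [floor_vec _ _ _]mxE; have /intrP[m ->] := Mz i 0.
by rewrite ler_int floor_ge_int.
Qed.

(** [z] may have negative entries because reachability looks back at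
    configurations from which [c] is obtained by firing. *)
Definition same_firings L M c L' M' c' : Prop :=
  forall z, z \is a mxOver Num.int ->
    valid L M (c - L *m z) <-> valid L' M' (c' - L' *m z).

Section Transfer.
Context {L M : 'M[R]_n} {c : 'cV[R]_n} {L' M' : 'M[R]_n} {c' : 'cV[R]_n}.
Context (same : same_firings L M c L' M' c').

Lemma same_firings_valid : valid L M c -> valid L' M' c'.
Proof. by have := same 0 (mxOver_int0 _ _); rewrite !mulmx0 !subr0 => -[]. Qed.

Lemma z_superstable_transfer : z_superstable L M c -> z_superstable L' M' c'.
Proof.
case=> /same_firings_valid vc' hc; split=> // z znat z0 vz.
by apply: (hc z znat z0); apply/same => //; apply: mxOver_nat_int.
Qed.

Lemma stable_transfer : stable L M c -> stable L' M' c'.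
Proof.
case=> /same_firings_valid vc' hc; split=> // i vi.
by apply: (hc i); apply/same => //; apply: basis_vec_int.
Qed.

(** The same firing sequence [s] works for [c'], started from
    [c' + L' (firing_vec s)]. *)
Lemma reachable_transfer : reachable L M c -> reachable L' M' c'.
Proof.
case=> d [s []]; rewrite sum_mul_basis_vec; set z0 := firing_vec s.
move=> vd vdi cE vs.
have z0int : z0 \is a mxOver Num.int := firing_vec_int s.
have back (A : 'M[R]_n) (b z : 'cV[R]_n) :
    b + A *m z0 - A *m z = b - A *m (z - z0).
  by rewrite mulmxBr opprB addrA.
have dE : d = c + L *m z0 by rewrite cE subrK.
have fire z : z \is a mxOver Num.int ->
    valid L M (d - L *m z) -> valid L' M' (c' + L' *m z0 - L' *m z).
  by move=> zint; rewrite dE !back => /same; apply; apply: mxOver_intB.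
exists (c' + L' *m z0), s; split.
- have := fire 0 (mxOver_int0 _ _); rewrite !mulmx0 !subr0; exact.
- by move=> i; apply: fire => //; apply: basis_vec_int.
- by rewrite sum_mul_basis_vec addrK.
- move=> l /vs; rewrite !sum_mul_basis_vec; apply: fire.
  exact: firing_vec_int.
Qed.

Lemma critical_transfer : critical L M c -> critical L' M' c'.
Proof. by case=> /stable_transfer ? /reachable_transfer ?. Qed.

End Transfer.

Lemma same_firings_sym L M c L' M' c' :
  same_firings L M c L' M' c' -> same_firings L' M' c' L M c.
Proof. by move=> same z zint; apply: iff_sym; apply: same. Qed.

End FiringEquivalence.

Theorem theorem3p2 (R : realType) (n : nat) (L M : 'M[R]_n) (c : 'cV[R]_n) :
  chip_firing_pair L M -> integral_pair L M -> valid L M c ->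
  (z_superstable L M c <->
     z_superstable M M (floor_vec (M *m invmx L *m c))) /\
  (critical L M c <-> critical M M (floor_vec (M *m invmx L *m c))).
Proof.
move=> [uL [_ _ uM _]] [Lint Mint] [cint _].
have same : same_firings L M c M M (floor_vec (M *m invmx L *m c)).
  by move=> z zint; apply: valid_sub_floor_vec.
have same' := same_firings_sym _ _ _ _ _ _ same.
split; split.
- exact: z_superstable_transfer same.
- exact: z_superstable_transfer same'.
- exact: critical_transfer same.
- exact: critical_transfer same'.
Qed.
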